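(* Let $k$ be a field and let six points $A_1,\dots,A_6$ in $\mathbb{A}^2(k)$ be given, no three collinear, and such that (indices modulo $6$) the six points $B_{i,i+1}=\langle A_{i-1},A_{i+1}\rangle\cap\langle A_i,A_{i+2}\rangle$ are finite. Let $g_i$ be the axis through $A_i$. Then the following are equivalent: (1) the six axes $g_1,\dots,g_6$ lie in a pencil; (2) for some $i$ the axes $g_{i-1},g_i,g_{i+1}$ lie in a pencil; (3) the main diagonals $\langle A_1,A_4\rangle$, $\langle A_2,A_5\rangle$, $\langle A_3,A_6\rangle$ of the hexagon $A_1A_2A_3A_4A_5A_6$ lie in a pencil; (4) the six points $B_{1,2},B_{2,3},B_{3,4},B_{4,5},B_{5,6},B_{6,1}$ lie on a conic.
   Context: The affine plane $\mathbb{A}^2(k)$ over an arbitrary field $k$ is viewed as embedded in $\mathbb{P}^2(k)$; lines are projective lines, ''finite'' points are the points of $\mathbb{A}^2(k)$, and two lines different from the line at infinity are parallel if their intersection point is at infinity. $\langle X,Y\rangle$ is the line through the distinct points $X,Y$. Lines lie in a pencil if they are concurrent or parallel, i.e. if they have a common point in $\mathbb{P}^2(k)$. Axis: let $(P,Q)$ and $(R,S)$ be two pairs of finite points on a line $l$ ($P=Q$ or $R=S$ allowed, but neither $R$ nor $S$ coinciding with $P$ or $Q$) and let $A\notin l$ be a finite point. Let $l_P$ be the line through $P$ parallel to $\langle A,R\rangle$, $l_S$ the line through $S$ parallel to $\langle A,Q\rangle$, and $B=l_P\cap l_S$. The line $\langle A,B\rangle$ is the axis of the configuration. The axis $g_i$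 through $A_i$ is obtained with $A=A_i$, $l=l_i=\langle A_{i-1},A_{i+1}\rangle$, $(P,Q)=(A_{i-1},B_{i-1,i})$ and $(R,S)=(B_{i,i+1},A_{i+1})$. Explicitly, $g_i=\langle A_i,E_i\rangle$, where $E_i$ is the intersection of the line through $A_{i-1}$ parallel to $\langle A_i,A_{i+2}\rangle$ with the line through $A_{i+1}$ parallel to $\langle A_i,A_{i-2}\rangle$. *)

(* Defs.v *)
From HB Require Import structures.
From mathcomp Require Import all_boot all_order all_algebra.
Set Implicit Arguments.
Unset Strict Implicit.
Unset Printing Implicit Defensive.
Import GRing.Theory.
Local Open Scope ring_scope.

(* Points and lines of P^2(k) are both given by homogeneous coordinates, that
   is by nonzero vectors of k^3 up to scaling. *)

Section ProjectivePlane.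
Variable k : fieldType.
Implicit Types (p q l m : 'rV[k]_3).

Definition incident p l : bool := p *m l^T == 0.

(* Coordinate indices are added modulo 3, since 'I_3 is Z/3. *)
Definition crossmul (u v : 'rV[k]_3) : 'rV[k]_3 :=
  \row_(i < 3) (u 0 (i + 1) * v 0 (i + 2) - u 0 (i + 2) * v 0 (i + 1)).

(* The line <p, q>, for p and q distinct (the value is 0 if p = q). *)
Definition join p q : 'rV[k]_3 := crossmul p q.

(* The common point of l and m, for l and m distinct (0 if l = m). *)
Definition meet l m : 'rV[k]_3 := crossmul l m.

(* The embedding (x, y) |-> (x : y : 1) of A^2(k) into P^2(k). *)
Definition homog (a : 'rV[k]_2) : 'rV[k]_3 := row_mx a (1 : 'rV[k]_1).

Definition linf : 'rV[k]_3 := delta_mx 0 ord_max.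

Definition finite_pt p : bool := ~~ incident p linf.

Definition collinear (ps : seq 'rV[k]_3) : Prop :=
  exists2 l : 'rV[k]_3, l != 0 & {in ps, forall p, incident p l}.

Definition pencil (ls : seq 'rV[k]_3) : Prop :=
  exists2 p : 'rV[k]_3, p != 0 & {in ls, forall l, incident p l}.

(* Triangular matrices Q <> 0 correspond bijectively to nonzero ternary
   quadratic forms, in any characteristic. Degenerate conics are allowed. *)
Definition on_conic (ps : seq 'rV[k]_3) : Prop :=
  exists Q : 'M[k]_3, [/\ is_trig_mx Q, Q != 0
    & {in ps, forall p, p *m Q *m p^T = 0}].

(* The line through p parallel to l, for l different from the line at infinity:
   it joins p to the point at infinity of l. *)
Definition parallel_through p l : 'rV[k]_3 := join p (meet l linf).

Definition axis (A P Q R S : 'rV[k]_3) : 'rV[k]_3 :=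
  join A (meet (parallel_through P (join A R)) (parallel_through S (join A Q))).

End ProjectivePlane.

Section Hexagon.
Variables (k : fieldType) (A : 'Z_6 -> 'rV[k]_2).

Definition hex_line (i j : 'Z_6) : 'rV[k]_3 := join (homog (A i)) (homog (A j)).

(* hexB i is B_{i,i+1}. *)
Definition hexB (i : 'Z_6) : 'rV[k]_3 :=
  meet (hex_line (i - 1) (i + 1)) (hex_line i (i + 2)).

(* The axis g_i, with (P, Q) = (A_{i-1}, B_{i-1,i}) and
   (R, S) = (B_{i,i+1}, A_{i+1}). *)
Definition hex_axis (i : 'Z_6) : 'rV[k]_3 :=
  axis (homog (A i))
    (homog (A (i - 1))) (hexB (i - 1)) (hexB i) (homog (A (i + 1))).

End Hexagon.

(* Main.v *)
(* The line coordinates of g_i are, up to a nonzero square, a combination of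
   brackets (3x3 determinants of homogeneous coordinates). Evaluating
   g_{i-1}, g_i, g_{i+1} at A_{i-1}, A_i, A_{i+1} gives only products of brackets
   and of third coordinates of the B's, so Ceva's identity and one bracket
   identity yield det(g_{i-1}, g_i, g_{i+1}) = c det(diagonals) with c <> 0;
   hence (2) <-> (3). The B's being finite also means that g_i avoids A_{i+1},
   so consecutive axes are distinct and the concurrent triples of consecutive
   axes chain into one pencil. For (3) <-> (4), the B's lie in pairs on the sides
   of the triangle A_1 A_3 A_5, and Carnot's criterion for six such points to lie
   on a conic is the vanishing of a bracket polynomial which equals
   -[A_2 A_4 A_6] det(diagonals). *)
Require Import Defs.
From HB Require Import structures.
From mathcomp Require Import all_boot all_order all_algebra.
From mathcomp Require Import ring.
Set Implicit Arguments.
Unset Strict Implicit.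
Unset Printing Implicit Defensive.
Import GRing.Theory.
Local Open Scope ring_scope.

(** * Bracket calculus for points and lines of the projective plane *)

Section ProjectiveBrackets.
Variable k : fieldType.
Implicit Types (u v w p q : 'rV[k]_3).

Definition dot u v : k := (u *m v^T) 0 0.

Lemma ord3_cycle :
  ((1 + 1 = 2 :> 'I_3) * (1 + 2 = 0 :> 'I_3))
  * ((2 + 1 = 0 :> 'I_3) * (2 + 2 = 1 :> 'I_3)).
Proof. by do !split; apply/val_inj. Qed.

Lemma dotE u v :
  dot u v = u 0 0 * v 0 0 + u 0 1 * v 0 1 + u 0 2 * v 0 2.
Proof.
rewrite /dot mxE !big_ord_recl big_ord0 addr0 !mxE addrA.
by congr (_ + u 0 _ * v 0 _ + u 0 _ * v 0 _); apply/val_inj.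
Qed.

Lemma crossmul0 u v : crossmul u v 0 0 = u 0 1 * v 0 2 - u 0 2 * v 0 1.
Proof. by rewrite mxE !add0r. Qed.

Lemma crossmul1 u v : crossmul u v 0 1 = u 0 2 * v 0 0 - u 0 0 * v 0 2.
Proof. by rewrite mxE !ord3_cycle. Qed.

Lemma crossmul2 u v : crossmul u v 0 2 = u 0 0 * v 0 1 - u 0 1 * v 0 0.
Proof. by rewrite mxE !ord3_cycle. Qed.

Lemma row3P u v :
  u 0 0 = v 0 0 -> u 0 1 = v 0 1 -> u 0 2 = v 0 2 -> u = v.
Proof.
move=> u0 u1 u2; apply/rowP; case=> [[|[|[|//]]] lti].
- by rewrite (_ : Ordinal lti = 0) //; apply/val_inj.
- by rewrite (_ : Ordinal lti = 1) //; apply/val_inj.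
- by rewrite (_ : Ordinal lti = 2) //; apply/val_inj.
Qed.

Definition crossE := (crossmul0, crossmul1, crossmul2).

Definition bracket u v w := dot u (crossmul v w).

Lemma row_addE u v j : (u + v) 0 j = u 0 j + v 0 j.
Proof. by rewrite mxE. Qed.

Lemma row_oppE u j : (- u) 0 j = - u 0 j.
Proof. by rewrite mxE. Qed.

Lemma row_scaleE c u j : (c *: u) 0 j = c * u 0 j.
Proof. by rewrite mxE. Qed.

Definition coordE := (row_addE, row_oppE, row_scaleE, crossE, dotE).

Lemma dotC u v : dot u v = dot v u.
Proof. by rewrite !dotE; ring. Qed.

Lemma dotZl c u v : dot (c *: u) v = c * dot u v.
Proof. by rewrite !coordE; ring. Qed.

Lemma dotZr c u v : dot u (c *: v) = c * dot u v.
Proof. by rewrite !coordE; ring. Qed.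

Lemma dot_crossmull u v : dot u (crossmul u v) = 0.
Proof. by rewrite !coordE; ring. Qed.

Lemma dot_crossmulr u v : dot v (crossmul u v) = 0.
Proof. by rewrite !coordE; ring. Qed.

Lemma bracketC u v w : bracket u v w = bracket v w u.
Proof. by rewrite /bracket !coordE; ring. Qed.

Lemma crossmul_triple u v w :
  crossmul u (crossmul v w) = dot u w *: v - dot u v *: w.
Proof. by apply: row3P; rewrite !coordE; ring. Qed.

Lemma crossmulr0 u : crossmul u 0 = 0.
Proof. by apply/rowP => i; rewrite !mxE !mulr0 subr0. Qed.

Lemma crossmulZ a b u v : crossmul (a *: u) (b *: v) = (a * b) *: crossmul u v.
Proof. by apply: row3P; rewrite !coordE; ring. Qed.

Lemma bracketZ a b c u v w :
  bracket (a *: u) (b *: v) (c *: w) = a * b * c * bracket u v w.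
Proof. by rewrite /bracket crossmulZ dotZl dotZr !mulrA. Qed.

Lemma bracket_cramer u v w p : bracket u v w *: p =
  dot p u *: crossmul v w + dot p v *: crossmul w u + dot p w *: crossmul u v.
Proof. by apply: row3P; rewrite /bracket !coordE; ring. Qed.

Lemma bracket_cramer_dual u v w p : bracket u v w *: p =
  bracket p v w *: u + bracket p w u *: v + bracket p u v *: w.
Proof. by apply: row3P; rewrite /bracket !coordE; ring. Qed.

Lemma bracket_join a b c d e f :
  bracket (crossmul a b) (crossmul c d) (crossmul e f)
  = bracket a b e * bracket c d f - bracket a b f * bracket c d e.
Proof. by rewrite /bracket !coordE; ring. Qed.

Lemma bracket_adjacent_lines a b c z :
  bracket (crossmul a b) (crossmul b c) z = bracket a b c * dot b z.
Proof. by rewrite /bracket !coordE; ring. Qed.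

(** The product of the two brackets is the determinant of the 3x3 matrix of values of [l], [m], [n]
    at [p], [q], [r]. Its diagonal vanishes, so only the two 3-cycles survive. *)
Lemma ceva p q r l m n : dot p l = 0 -> dot q m = 0 -> dot r n = 0 ->
  bracket p q r * bracket l m n
  = dot q l * dot r m * dot p n + dot r l * dot p m * dot q n.
Proof.
have -> : bracket p q r * bracket l m n
  = dot p l * (dot q m * dot r n - dot q n * dot r m)
  - dot p m * (dot q l * dot r n - dot q n * dot r l)
  + dot p n * (dot q l * dot r m - dot q m * dot r l).
  by rewrite /bracket !coordE; ring.
by move=> -> -> ->; ring.
Qed.

Lemma crossmul_neq0 p u v :
  dot p u != 0 -> dot p v = 0 -> v != 0 -> crossmul u v != 0.
Proof.
move=> pu0 pv0; apply: contraNneq => uv0; have := crossmul_triple p u v.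
rewrite uv0 crossmulr0 pv0 scale0r sub0r => /esym/eqP.
by rewrite oppr_eq0 scaler_eq0 (negPf pu0).
Qed.

Lemma dot_bracket0 p u v w : bracket u v w = 0 -> crossmul u v != 0 ->
  dot p u = 0 -> dot p v = 0 -> dot p w = 0.
Proof.
move=> uvw0 uv0 pu pv; have := bracket_cramer u v w p.
rewrite uvw0 pu pv !scale0r !add0r => /esym/eqP.
by rewrite scaler_eq0 (negPf uv0) orbF => /eqP.
Qed.

Lemma incidentE p l : incident p l = (dot p l == 0).
Proof.
apply/eqP/eqP => [|pl0]; first by rewrite /dot => ->; rewrite mxE.
by apply/matrixP => i j; rewrite !ord1 [RHS]mxE.
Qed.

Lemma orthogonal_neq0 u v : exists2 w, w != 0 & dot w u = 0 /\ dot w v = 0.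
Proof.
pose M := row_mx u^T v^T.
have /rowV0Pn[w /sub_kermxP wM w0] : kermx M != 0.
  rewrite -mxrank_eq0 mxrank_ker subn_eq0 -ltnNge.
  exact: leq_ltn_trans (rank_leq_col _) _.
exists w => //; move: wM; rewrite mul_mx_row -row_mx0 => /eq_row_mx[wu wv].
by rewrite /dot wu wv mxE.
Qed.

Lemma bracket_eq0P u v w :
  bracket u v w = 0 <->
  exists2 p, p != 0 & [/\ dot p u = 0, dot p v = 0 & dot p w = 0].
Proof.
split=> [uvw0|[p p0 [pu pv pw]]]; last first.
  apply/eqP; have /eqP := bracket_cramer u v w p.
  by rewrite pu pv pw !scale0r !addr0 scaler_eq0 (negPf p0) orbF.
(* If [u] and [v] are independent, their cross product is the witness. If they are proportional and
   [u] is nonzero, a vector orthogonal to [u] is orthogonal to [v] as well, so only [u] and [w]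
   impose conditions. *)
have [uv0|uv0] := eqVneq (crossmul u v) 0; last first.
  exists (crossmul u v) => //.
  rewrite dotC dot_crossmull dotC dot_crossmulr dotC.
  by rewrite -[dot w _]/(bracket _ _ _) bracketC.
have [u0|u0] := eqVneq u 0.
  have [p p0 [pv pw]] := orthogonal_neq0 v w; exists p => //.
  by split=> //; rewrite u0 -(scale0r 0) dotZr mul0r.
have [p p0 [pu pw]] := orthogonal_neq0 u w; exists p => //; split=> //.
apply/eqP; have := crossmul_triple p u v.
rewrite uv0 crossmulr0 pu scale0r subr0 => /esym/eqP.
by rewrite scaler_eq0 (negPf u0) orbF.
Qed.

Lemma pencil3P l m n : pencil [:: l; m; n] <-> bracket l m n = 0.
Proof.
rewrite bracket_eq0P; split=> -[p p0 H]; exists p => //.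
  by split; apply/eqP; rewrite -incidentE H // !inE eqxx ?orbT.
case: H => pl pm pn q; rewrite !inE incidentE => /or3P[]/eqP->; exact/eqP.
Qed.

Lemma collinear3P p q r : collinear [:: p; q; r] <-> bracket p q r = 0.
Proof.
rewrite bracket_eq0P; split=> -[l l0 H]; exists l => //.
  by split; apply/eqP; rewrite dotC -incidentE H // !inE eqxx ?orbT.
case: H => pl pm pn q'; rewrite !inE incidentE dotC => /or3P[]/eqP->; exact/eqP.
Qed.

End ProjectiveBrackets.

(** * The axis as a combination of brackets, and its values at nearby vertices *)

Section Axis.
Variable k : fieldType.
Implicit Types (u v w l : 'rV[k]_3) (a p s n m : 'rV[k]_2).

(* The line <a, E> up to scaling, where E is the common point of the parallel to <a, n> through
   p and of the parallel to <a, m> through s: with a = A_i, p = A_{i-1},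
   s = A_{i+1}, n = A_{i+2}, m = A_{i-2}, this is g_i. *)
Definition axis_form (u p s n m : 'rV[k]_3) : 'rV[k]_3 :=
  bracket u s m *: crossmul p (n - u) - bracket u p n *: crossmul s (m - u).

Lemma homog0 a : homog a 0 0 = a 0 0.
Proof.
rewrite /homog -(row_mxEl a (1 : 'rV[k]_1)).
by congr (row_mx _ _ _ _); apply/val_inj.
Qed.

Lemma homog1 a : homog a 0 1 = a 0 1.
Proof.
rewrite /homog -(row_mxEl a (1 : 'rV[k]_1)).
by congr (row_mx _ _ _ _); apply/val_inj.
Qed.

Lemma homog2 a : homog a 0 2 = 1.
Proof.
have := row_mxEr a (1 : 'rV[k]_1) 0 0; rewrite [RHS]mxE eqxx => r1.
by rewrite -[RHS]r1 /homog; congr (row_mx _ _ _ _); apply/val_inj.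
Qed.

Definition homogE := (homog0, homog1, homog2).

Lemma linfE : (linf k 0 0 = 0) * (linf k 0 1 = 0) * (linf k 0 2 = 1).
Proof. by split; [split|]; rewrite mxE. Qed.

Lemma finite_ptE u : finite_pt u = (u 0 2 != 0).
Proof. by rewrite /finite_pt incidentE dotE !linfE !mulr0 !add0r mulr1. Qed.

Lemma meet_linf a n :
  meet (join (homog a) (homog n)) (linf k) = homog n - homog a.
Proof.
by apply: row3P; rewrite /meet /join !coordE !homogE !linfE; ring.
Qed.

Lemma meetZ c d u v : meet (c *: u) (d *: v) = (c * d) *: meet u v.
Proof. exact: crossmulZ. Qed.

(** Since [C] lies on the line through [a] and [n], joining [a] to [C] gives that line again up to
    the factor [- c]; likewise for [B] and [m]. The two factors multiply to the square. *)
Lemma axisE a p s n m :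
  let B := meet (join (homog m) (homog a)) (join (homog p) (homog s)) in
  let C := meet (join (homog p) (homog s)) (join (homog a) (homog n)) in
  axis (homog a) (homog p) B C (homog s)
  = bracket (homog a) (homog p) (homog s) ^+ 2
    *: axis_form (homog a) (homog p) (homog s) (homog n) (homog m).
Proof.
move=> B C; set c := bracket _ _ _.
have aC : join (homog a) C = - c *: join (homog a) (homog n).
  by rewrite /C /join /meet crossmul_triple dot_crossmull scale0r sub0r scaleNr.
have aB : join (homog a) B = - c *: join (homog a) (homog m).
  by apply: row3P; rewrite /B /c /join /meet /bracket !coordE; ring.
have par q l x : parallel_through q (x *: l) = x *: parallel_through q l.
  by apply: row3P; rewrite /parallel_through /join /meet !coordE; ring.
rewrite /axis aC aB !par /parallel_through !meet_linf meetZ mulrNN -expr2.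
rewrite -[homog a in LHS]scale1r [in LHS]/join [in LHS]crossmulZ mul1r.
congr (_ *: _).
by apply: row3P; rewrite /axis_form /bracket /meet /join !coordE !homogE; ring.
Qed.

Lemma axis_form_apex u v w l l' : dot u (axis_form u v w l l') = 0.
Proof. by rewrite /axis_form /bracket !coordE; ring. Qed.

(** The [meet] is $B_{i,i+1}$ here and $B_{i-1,i}$ in the lemma after it: this is where finiteness
    of these points enters, as a nonzero third coordinate. *)
Lemma axis_form_next a p s n m :
  dot (homog s) (axis_form (homog a) (homog p) (homog s) (homog n) (homog m))
  = - (bracket (homog a) (homog s) (homog m)
    * meet (join (homog p) (homog s)) (join (homog a) (homog n)) 0 2).
Proof. by rewrite /axis_form /bracket /meet /join !coordE !homogE; ring. Qed.

Lemma axis_form_prev a p s n m :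
  dot (homog p) (axis_form (homog a) (homog p) (homog s) (homog n) (homog m))
  = - (bracket (homog a) (homog p) (homog n)
    * meet (join (homog m) (homog a)) (join (homog p) (homog s)) 0 2).
Proof. by rewrite /axis_form /bracket /meet /join !coordE !homogE; ring. Qed.

Lemma axis_form_next2 a p s n m :
  dot (homog n) (axis_form (homog a) (homog p) (homog s) (homog n) (homog m))
  = - (bracket (homog a) (homog p) (homog n)
    * bracket (homog a) (homog m) (homog n)).
Proof. by rewrite /axis_form /bracket !coordE !homogE; ring. Qed.

Lemma axis_form_prev2 a p s n m :
  dot (homog m) (axis_form (homog a) (homog p) (homog s) (homog n) (homog m))
  = - (bracket (homog a) (homog s) (homog m)
    * bracket (homog a) (homog m) (homog n)).
Proof. by rewrite /axis_form /bracket !coordE !homogE; ring. Qed.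

(** The sum on the right is what Ceva's identity leaves for three consecutive axes once the factors
    common to its two terms are taken out. *)
Lemma diagonals_bracket (u0 u1 u2 u3 u4 u5 : 'rV[k]_3) :
  bracket u5 u0 u1 * bracket (join u5 u2) (join u0 u3) (join u1 u4)
  = - (bracket u5 u0 u3 * bracket u0 u1 u4 * bracket u1 u2 u5
       + bracket u0 u5 u2 * bracket u1 u0 u3 * bracket u5 u4 u1).
Proof. by rewrite /join bracket_join /bracket !coordE; ring. Qed.

Lemma axes_bracket (a0 a1 a2 a3 a4 a5 : 'rV[k]_2) :
  let P0 := homog a0 in let P1 := homog a1 in let P2 := homog a2 in
  let P3 := homog a3 in let P4 := homog a4 in let P5 := homog a5 in
  bracket P5 P0 P1 * bracket (axis_form P5 P4 P0 P1 P3)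
    (axis_form P0 P5 P1 P2 P4) (axis_form P1 P0 P2 P3 P5)
  = bracket P5 P0 P1 * (bracket P1 P5 P3
    * meet (join P4 P0) (join P5 P1) 0 2 * meet (join P5 P1) (join P0 P2) 0 2
    * bracket (join P5 P2) (join P0 P3) (join P1 P4)).
Proof.
move=> P0 P1 P2 P3 P4 P5.
rewrite (ceva (axis_form_apex _ _ _ _ _) (axis_form_apex _ _ _ _ _)
  (axis_form_apex _ _ _ _ _)).
rewrite (axis_form_next a5) (axis_form_next a0) (axis_form_prev2 a1).
rewrite (axis_form_next2 a5) (axis_form_prev a0) (axis_form_prev a1).
rewrite -/P0 -/P1 -/P2 -/P3 -/P4 -/P5 (bracketC P5 P3 P1) (bracketC P3 P1 P5).
rewrite [RHS]mulrCA diagonals_bracket.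
set x := bracket P1 P5 P3; set y := bracket P5 P0 P3; set z := bracket P0 P1 P4.
set t := bracket P1 P2 P5; set x' := bracket P0 P5 P2; set y' := bracket P1 P0 P3.
set z' := bracket P5 P4 P1; set w := meet _ _ 0 2; set w' := meet _ _ 0 2.
(* Both terms contain [x * w * w']; with the brackets opaque the identity has low degree. *)
by clearbody x y z t x' y' z' w w'; ring.
Qed.

End Axis.

(** * Ternary quadratic forms and Carnot's theorem *)

Section Carnot.
Variable k : fieldType.
Implicit Types (u v w l m n p : 'rV[k]_3) (Q : 'M[k]_3).

Definition bform Q u v : k := (u *m Q *m v^T) 0 0.

Definition qform Q u : k := bform Q u u.

Lemma qform_eq0 Q p : p *m Q *m p^T = 0 <-> qform Q p = 0.
Proof.
rewrite /qform /bform; split=> [->|pQ0]; first by rewrite mxE.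
by apply/matrixP => i j; rewrite !ord1 [RHS]mxE.
Qed.

Lemma bformE Q u v : bform Q u v =
  u 0 0 * Q 0 0 * v 0 0 + u 0 0 * Q 0 1 * v 0 1 + u 0 0 * Q 0 2 * v 0 2
  + (u 0 1 * Q 1 0 * v 0 0 + u 0 1 * Q 1 1 * v 0 1 + u 0 1 * Q 1 2 * v 0 2)
  + (u 0 2 * Q 2 0 * v 0 0 + u 0 2 * Q 2 1 * v 0 1 + u 0 2 * Q 2 2 * v 0 2).
Proof.
have uQ j : (u *m Q) 0 j = u 0 0 * Q 0 j + u 0 1 * Q 1 j + u 0 2 * Q 2 j.
  rewrite mxE !big_ord_recl big_ord0 addr0 addrA.
  by congr (_ + u 0 _ * Q _ _ + u 0 _ * Q _ _); apply/val_inj.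
by rewrite /bform -[LHS]/(dot (u *m Q) v) dotE !uQ; ring.
Qed.

Lemma qform_dyad u v p : qform (u^T *m v) p = dot p u * dot p v.
Proof.
rewrite /qform /bform mulmxA -mulmxA mxE big_ord1; congr (_ * _).
by rewrite dotC.
Qed.

Lemma qformD Q R p : qform (Q + R) p = qform Q p + qform R p.
Proof. by rewrite /qform /bform mulmxDr mulmxDl mxE. Qed.

Lemma qformZ c Q p : qform (c *: Q) p = c * qform Q p.
Proof. by rewrite /qform /bform -scalemxAr -scalemxAl mxE. Qed.

(** The polar form, written as a sum because [Q] need not be symmetric and 2 may vanish in [k]. *)
Definition polar Q u v : k := bform Q u v + bform Q v u.

Lemma qform_scale Q c u : qform Q (c *: u) = c ^+ 2 * qform Q u.
Proof. by rewrite /qform !bformE !coordE; ring. Qed.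

Lemma qform_comb Q x y u v :
  qform Q (x *: u + y *: v)
  = x ^+ 2 * qform Q u + x * y * polar Q u v + y ^+ 2 * qform Q v.
Proof.
by rewrite /polar /qform !bformE !coordE; ring.
Qed.

Lemma qform_comb3 Q x y z u v w :
  qform Q (x *: u + y *: v + z *: w)
  = x ^+ 2 * qform Q u + y ^+ 2 * qform Q v + z ^+ 2 * qform Q w
    + x * y * polar Q u v + y * z * polar Q v w + z * x * polar Q w u.
Proof.
by rewrite /polar /qform !bformE !coordE; ring.
Qed.

(** Adding the entries above the diagonal to their mirror images gives a triangular matrix with the
    same form. An alternating [Q] would fold to 0, so a nonzero value of the form is assumed rather
    than [Q != 0]. *)
Lemma on_conic_qform Q u (ps : seq 'rV[k]_3) :
  qform Q u != 0 -> {in ps, forall p, qform Q p = 0} -> on_conic ps.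
Proof.
move=> Qu Qps; pose T : 'M[k]_3 := \matrix_(i, j)
  if i == j then Q i i else if (j < i)%N then Q i j + Q j i else 0.
have TQ p : qform T p = qform Q p.
  by rewrite /qform !bformE !mxE /=; ring.
exists T; split.
- apply/is_trig_mxP => i j ij; rewrite mxE; case: eqP ij => [->|_].
    by rewrite ltnn.
  by rewrite ltnNge leq_eqVlt negb_or => /andP[_ /negPf->].
- by apply: contraNneq Qu => T0; rewrite -TQ T0 /qform /bform mulmx0 mul0mx mxE.
- by move=> p pps; apply/qform_eq0; rewrite TQ Qps.
Qed.

(** Values at basis vectors give the diagonal entries, and values at sums of two basis vectors give
    the others, over any field. *)
Lemma qform_trig_eq0 Q : is_trig_mx Q -> (forall p, qform Q p = 0) -> Q = 0.
Proof.
move=> /is_trig_mxP Qtrig Q0.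
have Qe (i : 'I_3) : Q i i = 0.
  have := Q0 (delta_mx 0 i).
  by rewrite /qform /bform -rowE trmx_delta -colE !mxE.
apply/matrixP => i j; rewrite [RHS]mxE; have [ij|ji|/val_inj->] := ltngtP i j.
- exact: Qtrig.
- have := Q0 (1 *: delta_mx 0 i + 1 *: delta_mx 0 j).
  rewrite qform_comb !Q0 /polar /bform -!rowE !trmx_delta -!colE !mxE (Qtrig j i) //.
  by rewrite !mulr0 !mulr1 !mul1r !addr0 add0r.
- exact: Qe.
Qed.

(* Carnot's theorem. Each of l, m, n passes through two of the six points, one on
   each of two sides of the triangle e1 e2 e3. *)
Lemma carnot e1 e2 e3 l m n :
  bracket e1 e2 e3 != 0 ->
  {in [:: e1; e2; e3],
    forall e, [&& dot e l != 0, dot e m != 0 & dot e n != 0]} ->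
  bracket l m (crossmul e2 e3) != 0 ->
  bracket m n (crossmul e3 e1) != 0 ->
  bracket n l (crossmul e1 e2) != 0 ->
  on_conic [:: meet (join e2 e3) l; meet (join e2 e3) m;
               meet (join e3 e1) m; meet (join e3 e1) n;
               meet (join e1 e2) n; meet (join e1 e2) l]
  <-> dot e1 l * dot e2 m * dot e3 n = dot e3 l * dot e1 m * dot e2 n.
Proof.
move=> e0 He lm0 mn0 nl0.
have /and3P[l1 m1 n1] := He e1 (mem_head _ _).
have /and3P[l2 m2 n2] : [&& dot e2 l != 0, dot e2 m != 0 & dot e2 n != 0].
  by apply: He; rewrite !inE eqxx orbT.
have /and3P[l3 m3 n3] : [&& dot e3 l != 0, dot e3 m != 0 & dot e3 n != 0].
  by apply: He; rewrite !inE eqxx !orbT.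
split=> [[Q [Qtrig Q0 HQ]]|E].
  set ps := (X in {in X, _}) in HQ.
  (* On the side through [e] and [f], the form vanishes at two points, distinct by the bracket
     hypothesis. This fixes the ratio of its values at [e] and [f], and if both values are 0 it
     vanishes on the whole side. *)
  have side e f x y :
     meet (join e f) x \in ps -> meet (join e f) y \in ps ->
     bracket x y (crossmul e f) != 0 -> dot e x != 0 -> dot f x != 0 ->
     qform Q e * (dot f x * dot f y) = qform Q f * (dot e x * dot e y)
     /\ (qform Q e = 0 -> qform Q f = 0 -> polar Q e f = 0).
    move=> /HQ/qform_eq0 Qx /HQ/qform_eq0 Qy xy0 ex0 fx0.
    have meetE z : meet (join e f) z = dot e z *: f + (- dot f z) *: e.
      by apply: row3P; rewrite /meet /join !coordE; ring.
    move: Qx Qy; rewrite !meetE !qform_comb => Qx Qy.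
    have polC : polar Q f e = polar Q e f by rewrite /polar addrC.
    have brE : bracket x y (crossmul e f)
      = dot e x * dot f y - dot f x * dot e y.
      by rewrite /bracket !coordE; ring.
    split.
      apply/eqP; rewrite -subr_eq0 -(mulrI_eq0 _ (lregP xy0)) brE; apply/eqP.
      (* These multipliers give the polar term the same coefficient in both equations, so it cancels
         in the difference. *)
      have := congr2
        (fun s t => dot e y * dot f y * s - dot e x * dot f x * t) Qx Qy.
      rewrite /= !mulr0 subr0 => H; rewrite -[RHS]oppr0 -H; ring.
    move=> qe qf; move: Qx; rewrite qe qf polC !mulr0 add0r addr0 => /eqP.
    by rewrite mulrN mulNr oppr_eq0 !mulf_eq0 (negPf ex0) (negPf fx0) => /eqP.
  have [] := side e2 e3 l m; rewrite ?inE ?eqxx ?orbT // => r23 p23.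
  have [] := side e3 e1 m n; rewrite ?inE ?eqxx ?orbT // => r31 p31.
  have [] := side e1 e2 n l; rewrite ?inE ?eqxx ?orbT // => r12 p12.
  (* If the form vanishes at one vertex, the ratios make it vanish at all three, hence on all sides,
     hence identically. *)
  have [q1|q1] := eqVneq (qform Q e1) 0.
    case/negP: Q0; apply/eqP/qform_trig_eq0 => // p.
    have q2 : qform Q e2 = 0.
      apply/eqP; move/esym/eqP: r12.
      by rewrite q1 mul0r !mulf_eq0 (negPf n1) (negPf l1) !orbF.
    have q3 : qform Q e3 = 0.
      apply/eqP; move/eqP: r31.
      by rewrite q1 mul0r !mulf_eq0 (negPf m1) (negPf n1) !orbF.
    apply: (mulfI (expf_neq0 2 e0)); rewrite mulr0.
    rewrite -qform_scale bracket_cramer_dual qform_comb3 q1 q2 q3 p12 ?p23 ?p31 //; ring.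
  apply/eqP; rewrite -subr_eq0.
  have q2 : qform Q e2 != 0.
    apply: contra_neq q1 => q2; apply/eqP; move/eqP: r12.
    by rewrite q2 mul0r !mulf_eq0 (negPf n2) (negPf l2) !orbF.
  have q3 : qform Q e3 != 0.
    apply: contra_neq q1 => q3; apply/eqP; move/esym/eqP: r31.
    by rewrite q3 mul0r !mulf_eq0 (negPf m3) (negPf n3) !orbF.
  (* Multiplying the three ratio relations yields Carnot's equation times a common factor, which is
     nonzero. *)
  have : qform Q e1 * qform Q e2 * qform Q e3
     * (dot e2 l * dot e3 m * dot e1 n)
     * (dot e1 l * dot e2 m * dot e3 n - dot e3 l * dot e1 m * dot e2 n) = 0.
    have := congr2 *%R (congr2 *%R r23 r31) r12.
    by move=> /eqP; rewrite -subr_eq0 => /eqP H; rewrite -[RHS]oppr0 -H; ring.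
  move=> /eqP; rewrite mulf_eq0 => /orP[|//].
  rewrite !mulf_eq0 (negPf q1) (negPf q2) (negPf q3).
  by rewrite (negPf l2) (negPf m3) (negPf n1).
(* The restriction of Q to the side <e2, e3> is proportional to l * m, to
   <e3, e1> to m * n, and to <e1, e2> to n * l; b, c, d make the coefficients of
   the squares agree. *)
pose X := crossmul e2 e3; pose Y := crossmul e3 e1; pose Z := crossmul e1 e2.
pose b := dot e2 n * dot e3 n; pose c := dot e2 m * dot e3 n.
pose d := dot e3 l * dot e2 n.
pose Q := (d * (dot e1 m * dot e1 n)) *: (X^T *m X)
  + (b * (dot e2 l * dot e2 m)) *: (Y^T *m Y)
  + (b * (dot e3 l * dot e3 m)) *: (Z^T *m Z)
  + (b * (dot e2 l * dot e3 m + dot e3 l * dot e2 m)) *: (Y^T *m Z)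
  + (d * (dot e3 m * dot e1 n + dot e1 m * dot e3 n)) *: (Z^T *m X)
  + (c * (dot e1 n * dot e2 l + dot e2 n * dot e1 l)) *: (X^T *m Y).
have coordP x y z p : p = x *: e1 + y *: e2 + z *: e3 ->
  (dot p X = x * bracket e1 e2 e3) * (dot p Y = y * bracket e1 e2 e3)
  * (dot p Z = z * bracket e1 e2 e3).
  by move=> ->; rewrite /X /Y /Z /bracket; do !split; rewrite !coordE; ring.
have QE p x y z : p = x *: e1 + y *: e2 + z *: e3 ->
  qform Q p = bracket e1 e2 e3 ^+ 2 *
  (d * (dot e1 m * dot e1 n) * x ^+ 2
   + b * (dot e2 l * dot e2 m) * y ^+ 2
   + b * (dot e3 l * dot e3 m) * z ^+ 2
   + b * (dot e2 l * dot e3 m + dot e3 l * dot e2 m) * (y * z)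
   + d * (dot e3 m * dot e1 n + dot e1 m * dot e3 n) * (z * x)
   + c * (dot e1 n * dot e2 l + dot e2 n * dot e1 l) * (x * y)).
  by move=> pE; rewrite /Q !qformD !qformZ !qform_dyad !(coordP _ _ _ _ pE); ring.
(* Carnot's equation enters here: it makes the coefficients of $x^2$ required on the sides <e3, e1>
   and <e1, e2> equal. *)
have dc : d * dot e1 m = c * dot e1 l by rewrite /d /c mulrAC -E; ring.
apply: (@on_conic_qform Q e1).
  rewrite (QE _ 1 0 0); last by rewrite !scale0r !addr0 scale1r.
  rewrite expr0n /= mul0r !mulr0 mul0r !mulr0 !addr0 expr1n mulr1.
  by rewrite !mulf_neq0 ?expf_neq0.
have m23 x : meet (join e2 e3) x = 0 *: e1 + (- dot e3 x) *: e2 + dot e2 x *: e3.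
  by apply: row3P; rewrite /meet /join !coordE; ring.
have m31 x : meet (join e3 e1) x = dot e3 x *: e1 + 0 *: e2 + (- dot e1 x) *: e3.
  by apply: row3P; rewrite /meet /join !coordE; ring.
have m12 x : meet (join e1 e2) x = (- dot e2 x) *: e1 + dot e1 x *: e2 + 0 *: e3.
  by apply: row3P; rewrite /meet /join !coordE; ring.
move=> p; rewrite !inE => /orP[/eqP->|/orP[/eqP->|/orP[/eqP->|
  /orP[/eqP->|/orP[/eqP->|/eqP->]]]]].
- by rewrite (QE _ _ _ _ (m23 _)); ring.
- by rewrite (QE _ _ _ _ (m23 _)); ring.
- by rewrite (QE _ _ _ _ (m31 _)) /b /d; ring.
- by rewrite (QE _ _ _ _ (m31 _)) /b /d; ring.
- by rewrite (QE _ _ _ _ (m12 _)) mulrA dc /b /c; ring.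
- by rewrite (QE _ _ _ _ (m12 _)) mulrA dc /b /c; ring.
Qed.

End Carnot.

(** * The hexagon: each condition becomes the vanishing of [diagonals] *)

Section Hexagon.
Variable k : fieldType.
Implicit Types (A : 'Z_6 -> 'rV[k]_2) (g h i j l : 'Z_6).

(** The left side is the difference of the two sides of Carnot's equation for the triangle
    [u1 u3 u5] cut by the sides of [u0 u2 u4]. *)
Lemma desargues (u0 u1 u2 u3 u4 u5 : 'rV[k]_3) :
  bracket u1 u2 u4 * bracket u3 u4 u0 * bracket u5 u0 u2
  - bracket u5 u2 u4 * bracket u1 u4 u0 * bracket u3 u0 u2
  = - bracket u2 u4 u0 * bracket (join u5 u2) (join u0 u3) (join u1 u4).
Proof. by rewrite /join bracket_join /bracket !coordE; ring. Qed.

Definition generic_hexagon A :=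
  (forall i j l, uniq [:: i; j; l] ->
     bracket (homog (A i)) (homog (A j)) (homog (A l)) != 0)
  /\ (forall i, hexB A i 0 2 != 0).

(** Cyclic relabelling moves any vertex to index 0, where indices are numerals. *)
Definition rotate i A j := A (i + j).

Lemma hexB_rotate i j A : hexB (rotate i A) j = hexB A (i + j).
Proof. by rewrite /hexB /hex_line /rotate !addrA. Qed.

Lemma hex_axis_rotate i j A : hex_axis (rotate i A) j = hex_axis A (i + j).
Proof. by rewrite /hex_axis !hexB_rotate /rotate !addrA. Qed.

Lemma generic_rotate i A : generic_hexagon A -> generic_hexagon (rotate i A).
Proof.
case=> hA hB; split=> [a b c abc|j]; last by rewrite hexB_rotate.
by apply: hA; rewrite (map_inj_uniq (addrI i) [:: a; b; c]).
Qed.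

Lemma hexBE A h i j l : h + 1 = i -> i + 1 = j -> j + 1 = l ->
  hexB A i
  = meet (join (homog (A h)) (homog (A j))) (join (homog (A i)) (homog (A l))).
Proof.
by move=> hi <- <-; rewrite /hexB /hex_line -addrA -[in i - 1]hi addrK.
Qed.

Lemma hex_axisE A g h i j l :
  g + 1 = h -> h + 1 = i -> i + 1 = j -> j + 1 = l ->
  hex_axis A i = bracket (homog (A i)) (homog (A h)) (homog (A j)) ^+ 2
    *: axis_form (homog (A i)) (homog (A h)) (homog (A j)) (homog (A l))
         (homog (A g)).
Proof.
move=> gh hi ij jl; have ih : i - 1 = h by rewrite -hi addrK.
by rewrite /hex_axis ih ij (hexBE A gh hi ij) (hexBE A hi ij jl) axisE.
Qed.

Lemma hex_axis_next A i : generic_hexagon A ->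
  dot (homog (A (i + 1))) (hex_axis A i) != 0.
Proof.
move=> /(generic_rotate i)[].
rewrite -[i in hex_axis _ i]addr0 -hex_axis_rotate -[A _]/(rotate i A 1).
move: (rotate i A) => {}A hA hB.
rewrite (@hex_axisE A 4 5 0 1 2); try exact/val_inj.
rewrite dotZr axis_form_next mulf_neq0 ?expf_neq0 ?oppr_eq0 ?mulf_neq0 ?hA //.
rewrite -(@hexBE A 5 0 1 2) //; exact/val_inj.
Qed.

Lemma hex_axis_apex A i : dot (homog (A i)) (hex_axis A i) = 0.
Proof.
rewrite (@hex_axisE A (i - 1 - 1) (i - 1) i (i + 1) (i + 1 + 1)) ?addrNK //.
by rewrite dotZr axis_form_apex mulr0.
Qed.

(** The vertex $A_{i+1}$ lies on $g_{i+1}$ but not on $g_i$, and $g_{i+1}$ is nonzero because it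
    avoids $A_{i+2}$. *)
Lemma hex_axes_distinct A i : generic_hexagon A ->
  crossmul (hex_axis A i) (hex_axis A (i + 1)) != 0.
Proof.
move=> gA.
apply: (crossmul_neq0 (hex_axis_next i gA) (hex_axis_apex A (i + 1))).
apply: contraNneq (hex_axis_next (i + 1) gA) => ->.
by rewrite -(scale0r 0) dotZr mul0r.
Qed.

Definition diagonals A :=
  bracket (hex_line A 5 2) (hex_line A 0 3) (hex_line A 1 4).

Lemma consecutive_axes A : generic_hexagon A ->
  bracket (hex_axis A 5) (hex_axis A 0) (hex_axis A 1) = 0 <-> diagonals A = 0.
Proof.
case=> hA hB.
rewrite (@hex_axisE A 3 4 5 0 1); try exact/val_inj.
rewrite (@hex_axisE A 4 5 0 1 2); try exact/val_inj.
rewrite (@hex_axisE A 5 0 1 2 3); try exact/val_inj.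
have b501 : bracket (homog (A 5)) (homog (A 0)) (homog (A 1)) != 0 by exact: hA.
(* The bracket of the three vertices, introduced by Ceva's identity, is nonzero and cancels. *)
rewrite bracketZ (mulfI b501 (axes_bracket _ _ _ _ _ _)).
rewrite -(@hexBE A 4 5 0 1); try exact/val_inj.
rewrite -(@hexBE A 5 0 1 2); try exact/val_inj.
rewrite -/(diagonals A).
set c := (X in X * (_ * diagonals A)); set d := (X in c * (X * _)).
have c0 : c != 0 by rewrite !mulf_neq0 ?expf_neq0 ?hA.
have d0 : d != 0 by rewrite !mulf_neq0 ?hA.
split=> [/eqP|->]; last by rewrite !mulr0.
by rewrite mulf_eq0 (negPf c0) mulf_eq0 (negPf d0) => /eqP.
Qed.

Lemma hex_lineC A i j : hex_line A i j = (-1) *: hex_line A j i.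
Proof. by apply: row3P; rewrite /hex_line /join !coordE; ring. Qed.

(** The shift permutes the three diagonals cyclically and reverses the direction of one, hence the
    sign. *)
Lemma diagonals_rotate1 A : diagonals (rotate 1 A) = - diagonals A.
Proof.
rewrite /diagonals.
have E i j i' j' : 1 + i = i' -> 1 + j = j' ->
  hex_line (rotate 1 A) i j = hex_line A i' j'.
  by move=> <- <-.
rewrite (E 5 2 0 3) ?(E 0 3 1 4) ?(E 1 4 2 5); try exact/val_inj.
rewrite (hex_lineC A 2 5) -[hex_line A 0 3]scale1r -[hex_line A 1 4]scale1r.
rewrite bracketZ !scale1r.
by rewrite !mul1r mulN1r -bracketC.
Qed.

Lemma diagonals_rotate i A : diagonals (rotate i A) = 0 <-> diagonals A = 0.
Proof.
rewrite -(natr_Zp i); elim: (i : nat) => [|n IH].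
  by rewrite /diagonals /hex_line /rotate !add0r.
rewrite -IH.
have -> : diagonals (rotate n.+1%:R A) = diagonals (rotate 1 (rotate n%:R A)).
  by rewrite /diagonals /hex_line /rotate -natr1 !addrA.
rewrite diagonals_rotate1.
by split=> [/eqP|->]; rewrite ?oppr0 // oppr_eq0 => /eqP.
Qed.

Lemma pencil_diagonals A :
  pencil [:: hex_line A 1 4; hex_line A 2 5; hex_line A 3 6] <-> diagonals A = 0.
Proof.
rewrite pencil3P /diagonals (_ : 6 = 0); last exact/val_inj.
rewrite (hex_lineC A 2 5) (hex_lineC A 3 0) -{1}[hex_line A 1 4]scale1r bracketZ.
by rewrite mul1r mulN1r opprK mul1r bracketC.
Qed.

Lemma pencil_consecutive_axes A i : generic_hexagon A ->
  pencil [:: hex_axis A (i - 1); hex_axis A i; hex_axis A (i + 1)]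
  <-> diagonals A = 0.
Proof.
move=> gA; rewrite pencil3P -(diagonals_rotate i).
rewrite -(consecutive_axes (generic_rotate i gA)).
rewrite !hex_axis_rotate addr0 (_ : 5 = -1) //; exact/val_inj.
Qed.

Lemma pencil_axes A : generic_hexagon A -> diagonals A = 0 ->
  pencil [seq hex_axis A i | i : 'Z_6].
Proof.
move=> gA dA; pose p := crossmul (hex_axis A 0) (hex_axis A (0 + 1)).
(* Two consecutive axes are carried along: being distinct and both through [p], they force the next
   axis of their concurrent triple through [p]. *)
have step (n : nat) :
  dot p (hex_axis A n%:R) = 0 /\ dot p (hex_axis A (n%:R + 1)) = 0.
  elim: n => [|n [IH1 IH2]].
    by split; [apply: etrans (dotC _ _) (dot_crossmull _ _)
             | apply: etrans (dotC _ _) (dot_crossmulr _ _)].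
  rewrite -(natr1 n); split; first exact: IH2.
  have /pencil3P := (pencil_consecutive_axes (n%:R + 1) gA).2 dA; rewrite addrK.
  by move=> /dot_bracket0/(_ (hex_axes_distinct _ gA) IH1 IH2).
exists p; first exact: hex_axes_distinct.
move=> _ /mapP[i _ ->]; rewrite incidentE -(natr_Zp i); apply/eqP.
exact: (step i).1.
Qed.

Lemma conic_diagonals A : generic_hexagon A ->
  on_conic [seq hexB A i | i : 'Z_6] <-> diagonals A = 0.
Proof.
case=> hA hB; pose P i := homog (A i).
(* The same six points, ordered for [carnot]: the triangle has vertices 1, 3, 5 and the cutting
   lines are the sides of the triangle 2, 4, 0. *)
pose ps := [:: meet (join (P 3) (P 5)) (join (P 2) (P 4));
               meet (join (P 3) (P 5)) (join (P 4) (P 0));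
               meet (join (P 5) (P 1)) (join (P 4) (P 0));
               meet (join (P 5) (P 1)) (join (P 0) (P 2));
               meet (join (P 1) (P 3)) (join (P 0) (P 2));
               meet (join (P 1) (P 3)) (join (P 2) (P 4))].
have meetC u v : meet u v = (-1) *: meet v u :> 'rV[k]_3.
  by apply: row3P; rewrite /meet !coordE; ring.
(* For odd [i], [hexB A i] takes its two lines in the opposite order; the resulting sign is lost in
   a quadratic form. *)
have qmeetC Q (u v : 'rV[k]_3) : qform Q (meet u v) = qform Q (meet v u).
  by rewrite meetC qform_scale sqrrN expr1n mul1r.
have B0 : hexB A 0 = meet (join (P 5) (P 1)) (join (P 0) (P 2)).
  by apply: hexBE; apply/val_inj.
have B1 : hexB A 1 = meet (join (P 0) (P 2)) (join (P 1) (P 3)).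
  by apply: hexBE; apply/val_inj.
have B2 : hexB A 2 = meet (join (P 1) (P 3)) (join (P 2) (P 4)).
  by apply: hexBE; apply/val_inj.
have B3 : hexB A 3 = meet (join (P 2) (P 4)) (join (P 3) (P 5)).
  by apply: hexBE; apply/val_inj.
have B4 : hexB A 4 = meet (join (P 3) (P 5)) (join (P 4) (P 0)).
  by apply: hexBE; apply/val_inj.
have B5 : hexB A 5 = meet (join (P 4) (P 0)) (join (P 5) (P 1)).
  by apply: hexBE; apply/val_inj.
have conicE : on_conic [seq hexB A i | i : 'Z_6] <-> on_conic ps.
  split=> -[Q [Qt Q0 HQ]]; exists Q; split=> // p.
    have H i : qform Q (hexB A i) = 0.
      by apply/qform_eq0/HQ; rewrite map_f ?mem_enum.
    rewrite !inE => /orP[/eqP->|/orP[/eqP->|/orP[/eqP->|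
      /orP[/eqP->|/orP[/eqP->|/eqP->]]]]]; apply/qform_eq0.
    - by rewrite qmeetC -B3.
    - by rewrite -B4.
    - by rewrite qmeetC -B5.
    - by rewrite -B0.
    - by rewrite qmeetC -B1.
    - by rewrite -B2.
  have H q : q \in ps -> qform Q q = 0 by move=> /HQ/qform_eq0.
  move=> /mapP[i _ ->]; apply/qform_eq0.
  have : i \in [:: 0; 1; 2; 3; 4; 5].
    by case: i => [[|[|[|[|[|[|//]]]]]] ?].
  rewrite !inE => /orP[/eqP->|/orP[/eqP->|/orP[/eqP->|
    /orP[/eqP->|/orP[/eqP->|/eqP->]]]]].
  - by rewrite B0 H // !inE eqxx ?orbT.
  - by rewrite B1 qmeetC H // !inE eqxx ?orbT.
  - by rewrite B2 H // !inE eqxx ?orbT.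
  - by rewrite B3 qmeetC H // !inE eqxx ?orbT.
  - by rewrite B4 H // !inE eqxx ?orbT.
  - by rewrite B5 qmeetC H // !inE eqxx ?orbT.
rewrite conicE carnot.
- have := desargues (P 0) (P 1) (P 2) (P 3) (P 4) (P 5).
  rewrite -/(diagonals A) => D; split=> [/eqP|d0]; last first.
    by apply/eqP; rewrite -subr_eq0 [X in X == 0]D d0 mulr0.
  rewrite -subr_eq0 [X in X == 0]D mulf_eq0 oppr_eq0 (negPf (hA _ _ _ _)) //.
  by move/eqP.
- exact: hA.
- by apply/allP; rewrite /= !hA.
(* Two cutting lines share a hexagon vertex off the side in question, so they meet that side at
   distinct points. *)
- by rewrite bracket_adjacent_lines mulf_neq0 ?hA.
- by rewrite bracket_adjacent_lines mulf_neq0 ?hA.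
- by rewrite bracket_adjacent_lines mulf_neq0 ?hA.
Qed.

End Hexagon.

Theorem theorem16 (k : fieldType) (A : 'Z_6 -> 'rV[k]_2)
    (hA : forall i j l : 'Z_6, uniq [:: i; j; l] ->
       ~ collinear [:: homog (A i); homog (A j); homog (A l)])
    (hB : forall i : 'Z_6, finite_pt (hexB A i)) :
  [<-> pencil [seq hex_axis A i | i : 'Z_6];
       exists i : 'Z_6,
         pencil [:: hex_axis A (i - 1); hex_axis A i; hex_axis A (i + 1)];
       pencil [:: hex_line A 1 4; hex_line A 2 5; hex_line A 3 6];
       on_conic [seq hexB A i | i : 'Z_6]].
Proof.
have gA : generic_hexagon A.
  split=> [i j l /hA ijl|i]; last by rewrite -finite_ptE.
  by apply/eqP => /collinear3P.
tfae.
- case=> p p0 Hp; exists 0, p => // l; rewrite !inE.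
  by case/or3P => /eqP->; apply: Hp; rewrite map_f ?mem_enum.
- by case=> i /(pencil_consecutive_axes i gA)/pencil_diagonals.
- by move=> /pencil_diagonals/(conic_diagonals gA).
- by move=> /(conic_diagonals gA)/(pencil_axes gA).
Qed.
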